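(* The Boolean function family $\mathrm{3SATC}=(\mathrm{3SATC}_n)_{n\in\mathbb N}$ is $\mathbf{NP}_{\mathrm{IS}}$-complete.
   Context: Let $\mathbb B=\{\mathsf T,\mathsf F\}$. There are Boolean registers named $\mathtt{in}{:}i$, $\mathtt{aux}{:}i$ ($i\ge1$) and $\mathtt{out}$, processing methods $\mathtt{set{:}T}$ (content becomes $\mathsf T$, reply $\mathsf T$), $\mathtt{set{:}F}$ (content becomes $\mathsf F$, reply $\mathsf F$), $\mathtt{get}$ (no change, reply is the content). Basic instructions are $f.m$. Primitive instructions: for each basic instruction $a$, the plain instruction $a$, positive test $+a$, negative test $-a$; forward jumps $\#l$ ($l\in\mathbb N$); termination $!$. An instruction sequence is a finite non-empty sequence $X=u_1;\dots;u_k$ of primitive instructions, $|X|=k$. Execution starts at $u_1$: $a$ executes $a$ and proceeds with the next instruction; $+a$ executes $a$ and proceeds with the next instruction if the reply is $\mathsf T$, otherwise skips the next instruction and proceeds with the one after; $-a$ likewise with reply roles reversed; $\#l$ proceeds with the $l$-th next instruction ($\#0$ causes inaction); $!$ terminates; if there is no instruction to proceed with, inaction occurs. $\mathcal{IS}_{br}$ is the set of instruction sequences whose basic instructions are all of the forms $\mathtt{in}{:}i.\mathtt{get}$, $\mathtt{aux}{:}i.\mathtt{get}$, $\mathtt{aux}{:}i.\mathtt{set{:}}b$, $\mathtt{out}.\mathtt{set{:}}b$. $X$ computes $f:\mathbb B^n\to\mathbb B$ if for all $b_1,\dots,b_n$, executing $X$ with $\mathtt{in}{:}i$ initially $b_i$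 ($i\le n$) and all auxiliary registers and $\mathtt{out}$ initially $\mathsf F$, execution never executes an instruction on $\mathtt{in}{:}i$ with $i>n$, ends by executing $!$, and leaves $f(b_1,\dots,b_n)$ in $\mathtt{out}$. A Boolean function family is a sequence $(f_n)_{n\in\mathbb N}$ with $f_n:\mathbb B^n\to\mathbb B$. $\mathbf P_{\mathrm{IS}}$ is the class of families $(g_n)$ for which there is a polynomial $h$ such that for every $n$ some $X\in\mathcal{IS}_{br}$ computes $g_n$ with $|X|\le h(n)$. $\mathbf{NP}_{\mathrm{IS}}$ is the class of families $(f_n)$ for which there exist a monotonic polynomial $h$ and $(g_n)\in\mathbf P_{\mathrm{IS}}$ with $f_n(w)=\mathsf T\iff\exists c\in\mathbb B^{h(n)}\,g_{n+h(n)}(wc)=\mathsf T$ for all $n$, $w\in\mathbb B^n$. Reducibility: for $l,m,n\in\mathbb N$, $f:\mathbb B^n\to\mathbb B$ and $g:\mathbb B^m\to\mathbb B$, $f\le_l g$ if there exist $h_1,\dots,h_m:\mathbb B^n\to\mathbb B$ computed by $X_1,\dots,X_m\in\mathcal{IS}_{br}$ with $|X_j|\le l$ such that $f(b)=g(h_1(b),\dots,h_m(b))$ for all $b\in\mathbb B^n$. A family $(f_n)$ is non-uniform polynomial-length reducible to $(g_n)$ if there is a polynomial $h$ such that for every $n$ there exist $l,m\le h(n)$ with $f_n\le_l g_m$. $(f_n)$ is $\mathbf{NP}_{\mathrm{IS}}$-complete if $(f_n)\in\mathbf{NP}_{\mathrm{IS}}$ and every family in $\mathbf{NP}_{\mathrm{IS}}$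 is non-uniform polynomial-length reducible to $(f_n)$. The family $\mathrm{3SATC}$: let $\mathrm{nd}(k)=\binom{2k}{1}+\binom{2k}{2}+\binom{2k}{3}$; fix bijections $\alpha_k:[1,\mathrm{nd}(k)]\to\{L\subseteq\{v_1,\neg v_1,\dots,v_k,\neg v_k\}\mid1\le|L|\le3\}$ with $\alpha_i^{-1}(\alpha_{i+1}(j))=j$ for all $i$ and $j\in[1,\mathrm{nd}(i)]$, such that $\alpha(i)=\alpha_{\min\{j\mid i\in[1,\mathrm{nd}(j)]\}}(i)$ is polynomial-time computable; if $n=\mathrm{nd}(k)$ then $\mathrm{3SATC}_n(b_1,\dots,b_n)=\mathsf T$ iff $\bigwedge_{i\in[1,n],\,b_i=\mathsf T}\bigvee\alpha_k(i)$ is satisfiable; if $\mathrm{nd}(k)<n<\mathrm{nd}(k+1)$ then $\mathrm{3SATC}_n(b_1,\dots,b_n)=\mathrm{3SATC}_{\mathrm{nd}(k)}(b_1,\dots,b_{\mathrm{nd}(k)})$. *)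

(* Defs.v *)
From HB Require Import structures.
From mathcomp Require Import all_boot all_order all_algebra.

Set Implicit Arguments.
Unset Strict Implicit.
Unset Printing Implicit Defensive.

Import Order.TTheory GRing.Theory Num.Theory.

(* [In i] and [Aux i] are the registers in:(i+1) and aux:(i+1). *)
Inductive reg := In of nat | Aux of nat | Out.

Definition same_reg (f g : reg) : bool :=
  match f, g with
  | In i, In j => i == j
  | Aux i, Aux j => i == j
  | Out, Out => true
  | _, _ => false
  end.

Inductive method := Set_ of bool | Get.

Record basic := Basic { focus : reg; meth : method }.

Inductive instr :=
  | Plain of basic
  | PosTest of basic
  | NegTest of basic
  | Jump of nat
  | Term.

Definition basic_br (a : basic) : bool :=
  match focus a, meth a with
  | In _, Get => true
  | Aux _, _ => true
  | Out, Set_ _ => true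
  | _, _ => false
  end.

Definition instr_br (u : instr) : bool :=
  match u with
  | Plain a | PosTest a | NegTest a => basic_br a
  | _ => true
  end.

Definition IS_br (X : seq instr) : bool := (0 < size X) && all instr_br X.

Definition regs := reg -> bool.

Definition reply (s : regs) (a : basic) : bool :=
  match meth a with Set_ b => b | Get => s (focus a) end.

Definition effect (s : regs) (a : basic) : regs :=
  match meth a with
  | Set_ b => fun f => if same_reg f (focus a) then b else s f
  | Get => s
  end.

Definition in_range (n : nat) (a : basic) : bool :=
  if focus a is In i then i < n else true.

(* [exec n X p s s']: executing X from its (p+1)-th instruction with register
   contents s ends by executing the termination instruction, with contents s',
   and meets no instruction on in:i with i > n. Inaction (a jump of length 0,
   or no instruction left to proceed with) has no derivation. *)
Inductive exec (n : nat) (X : seq instr) : nat -> regs -> regs -> Prop :=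
  | exec_plain p a s s' :
      onth X p = Some (Plain a) -> in_range n a ->
      exec n X p.+1 (effect s a) s' -> exec n X p s s'
  | exec_pos p a s s' :
      onth X p = Some (PosTest a) -> in_range n a ->
      exec n X (if reply s a then p.+1 else p.+2) (effect s a) s' ->
      exec n X p s s'
  | exec_neg p a s s' :
      onth X p = Some (NegTest a) -> in_range n a ->
      exec n X (if reply s a then p.+2 else p.+1) (effect s a) s' ->
      exec n X p s s'
  | exec_jump p l s s' :
      onth X p = Some (Jump l) -> 0 < l ->
      exec n X (p + l) s s' -> exec n X p s s'
  | exec_term p s :
      onth X p = Some Term -> exec n X p s s.

Definition init (n : nat) (b : n.-tuple bool) : regs :=
  fun f => if f is In i then nth false b i else false.

Definition computes (n : nat) (X : seq instr) (f : n.-tuple bool -> bool) :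
    Prop :=
  forall b : n.-tuple bool,
    exists2 s : regs, exec n X 0 (init b) s & s Out = f b.

Definition family := forall n : nat, n.-tuple bool -> bool.

(* Rational coefficients cover every polynomial that maps nat to nat. *)
Definition polynomial_fun (h : nat -> nat) : Prop :=
  exists p : {poly rat}, forall n : nat, ((h n)%:R = p.[n%:R])%R.

Definition P_IS (g : family) : Prop :=
  exists2 h : nat -> nat, polynomial_fun h &
    forall n : nat, exists X : seq instr,
      [/\ IS_br X, computes X (@g n) & size X <= h n].

Definition NP_IS (f : family) : Prop :=
  exists (h : nat -> nat) (g : family),
    [/\ polynomial_fun h, {homo h : m n / m <= n}, P_IS g &
      forall (n : nat) (w : n.-tuple bool),
        f n w <->
        exists c : (h n).-tuple bool, g (n + h n) [tuple of w ++ c]].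

Definition reducible_in (l m n : nat)
    (f : n.-tuple bool -> bool) (g : m.-tuple bool -> bool) : Prop :=
  exists h : 'I_m -> n.-tuple bool -> bool,
    (forall j : 'I_m, exists X : seq instr,
       [/\ IS_br X, computes X (h j) & size X <= l]) /\
    (forall b : n.-tuple bool, f b = g [tuple h j b | j < m]).

Definition poly_length_reducible (f g : family) : Prop :=
  exists2 h : nat -> nat, polynomial_fun h &
    forall n : nat, exists l m : nat,
      [/\ l <= h n, m <= h n & reducible_in l (@f n) (@g m)].

Definition NP_IS_complete (f : family) : Prop :=
  NP_IS f /\ forall f' : family, NP_IS f' -> poly_length_reducible f' f.

Definition nd (k : nat) : nat := 'C(2 * k, 1) + 'C(2 * k, 2) + 'C(2 * k, 3).

(* (i, true) is the literal v_(i+1), (i, false) its negation. *)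
Definition literal (k : nat) : finType := ('I_k * bool)%type.

Definition clause (k : nat) := {L : {set literal k} | 0 < #|L| <= 3}.

(* Position j : 'I_(nd k) stands for the number j+1 of [1, nd k]. *)
Definition clause_numbering := forall k : nat, 'I_(nd k) -> clause k.

Definition widen_literal (k : nat) (x : literal k) : literal k.+1 :=
  (widen_ord (leqnSn k) x.1, x.2).

(* The condition alpha_i^-1 (alpha_(i+1) j) = j: alpha_(i+1) j lies in the
   codomain of alpha_i, and is the value of alpha_i at j. *)
Definition coherent (alpha : clause_numbering) : Prop :=
  forall (i : nat) (j : 'I_(nd i)) (j' : 'I_(nd i.+1)), j = j' :> nat ->
    val (alpha i.+1 j') = [set widen_literal x | x in val (alpha i j)].

(* Binary digits, least significant first; none for 0. *)
Definition binary (n : nat) : seq bool :=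
  mkseq (fun i => odd (n %/ 2 ^ i)) (up_log 2 n.+1).

(* Input and output symbols: Some b is the bit b, None a separator. *)
Definition io_symbol := option bool.

(* Tape symbols: None is the blank. *)
Definition tape_symbol (W : Type) := option (io_symbol + W).

Inductive move := Left | Stay | Right.

(* Deterministic machines with one two-way infinite tape; [None] halts. *)
Record turing_machine := TuringMachine {
  tm_state : finType;
  tm_work : finType;
  tm_start : tm_state;
  tm_trans : tm_state -> tape_symbol tm_work ->
             option (tm_state * tape_symbol tm_work * move)
}.

(* [tape_left] is the tape left of the head, nearest cell first; the first
   cell of [tape_right] is the scanned one; all further cells are blank. *)
Record configuration (M : turing_machine) := Configuration {
  cf_state : tm_state M;
  tape_left : seq (tape_symbol (tm_work M));
  tape_right : seq (tape_symbol (tm_work M))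
}.

Definition tm_step (M : turing_machine) (c : configuration M) :
    option (configuration M) :=
  let l := tape_left c in
  let r := tape_right c in
  if tm_trans (cf_state c) (head None r) is Some (q, a, d) then
    Some (match d with
          | Left => Configuration q (behead l) (head None l :: a :: behead r)
          | Stay => Configuration q l (a :: behead r)
          | Right => Configuration q (a :: l) (behead r)
          end)
  else None.

Definition tm_word (M : turing_machine) (w : seq io_symbol) :
    seq (tape_symbol (tm_work M)) :=
  [seq Some (inl x) | x <- w].

Definition tm_run (M : turing_machine) (w : seq io_symbol) (t : nat) :
    configuration M :=
  iter t (fun c => odflt c (tm_step c))
       (Configuration (tm_start M) [::] (tm_word M w)).

(* M halts on w within t steps, and its output, read from the head rightwards
   up to the first blank, is v. *)
Definition tm_outputs (M : turing_machine) (w : seq io_symbol) (t : nat)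
    (v : seq io_symbol) : Prop :=
  let c := tm_run M w t in
  tm_step c = None /\
  forall i : nat, i <= size v ->
    nth None (tape_right c) i = nth None (tm_word M v) i.

Definition literal_code (k : nat) (x : literal k) : seq io_symbol :=
  Some x.2 :: [seq Some b | b <- binary x.1.+1] ++ [:: None].

(* Polynomial-time computability of the function sending the binary notation
   of i >= 1 to alpha_k(i), for the least k with i <= nd k. The resulting set
   of literals may be listed in any order. *)
Definition polytime_numbering (alpha : clause_numbering) : Prop :=
  exists (M : turing_machine) (h : nat -> nat), polynomial_fun h /\
    forall (k : nat) (j : 'I_(nd k)),
      (forall k' : nat, j < nd k' -> k <= k') ->
      exists2 s : seq (literal k), perm_eq s (enum (val (alpha k j))) &
        tm_outputs M [seq Some b | b <- binary j.+1] (h (size (binary j.+1)))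
          (flatten [seq literal_code x | x <- s]).

Definition selected_satisfiable (alpha : clause_numbering) (k : nat)
    (b : (nd k).-tuple bool) : bool :=
  [exists v : {ffun 'I_k -> bool}, forall j : 'I_(nd k),
     tnth b j ==> [exists x in val (alpha k j), v x.1 == x.2]].

(* The k with nd k <= n < nd (k+1), see [nd_level]. *)
Definition level (n : nat) : nat := \max_(k < n.+1 | nd k <= n) k.

Definition sat3c (alpha : clause_numbering) : family := fun n b =>
  selected_satisfiable alpha [tuple nth false b j | j < nd (level n)].

Lemma leq_nd (k : nat) : k <= nd k.
Proof.
rewrite /nd bin1 -addnA; apply: leq_trans (leq_addr _ _).
by rewrite mul2n -addnn leq_addr.
Qed.

Lemma nd_level (n : nat) : nd (level n) <= n < nd (level n).+1.
Proof.
have n0 : nd (@ord0 n) <= n by [].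
apply/andP; split.
  by rewrite /level (bigop.bigmax_eq_arg ord0) //; case: arg_maxnP.
rewrite ltnNge; apply/negP => le_n.
have ltk : (level n).+1 < n.+1 by rewrite ltnS (leq_trans (leq_nd _)).
have := @bigop.leq_bigmax_cond _ (fun k : 'I_n.+1 => nd k <= n)
          (fun k : 'I_n.+1 => k : nat) (Ordinal ltk) le_n.
by rewrite -/(level n) /= ltnn.
Qed.

(* Main.v *)
(* Membership: the witness is a truth assignment, and an instruction sequence
   evaluates the selected clauses one after the other.

   Hardness: describe the execution of the verifying sequence by Boolean trace
   variables (position at time t, register contents at time t). The reduction
   selects every clause of at most three literals that holds on all accepting
   traces, together with the unit clauses that fix the input w. Any satisfying
   assignment then agrees with some accepting trace on every triple of trace
   variables; since one execution step is determined by such triples, the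
   assignment can be replayed as a real accepting execution. As which clauses
   are selected depends on w only through the unit clauses, each bit of the
   reduction is a constant or a single literal. *)
Require Import Defs.
From mathcomp Require Import all_boot all_order all_algebra.
From mathcomp Require Import zify.

Set Implicit Arguments.
Unset Strict Implicit.
Unset Printing Implicit Defensive.

Import GRing.Theory.

(** * Polynomial bounds and the growth of [nd] *)

Lemma polynomial_fun_const c : polynomial_fun (fun=> c).
Proof. by exists (c%:R%:P)%R => n; rewrite hornerC. Qed.

Lemma polynomial_fun_id : polynomial_fun id.
Proof. by exists 'X%R => n; rewrite hornerX. Qed.

Lemma polynomial_fun_add h1 h2 :
  polynomial_fun h1 -> polynomial_fun h2 ->
  polynomial_fun (fun n => h1 n + h2 n).
Proof.
by move=> [p hp] [q hq]; exists (p + q)%R => n; rewrite hornerD natrD hp hq.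
Qed.

Lemma polynomial_fun_mul h1 h2 :
  polynomial_fun h1 -> polynomial_fun h2 ->
  polynomial_fun (fun n => h1 n * h2 n).
Proof.
by move=> [p hp] [q hq]; exists (p * q)%R => n; rewrite hornerM natrM hp hq.
Qed.

Lemma polynomial_fun_comp h1 h2 :
  polynomial_fun h1 -> polynomial_fun h2 ->
  polynomial_fun (fun n => h1 (h2 n)).
Proof.
by move=> [p hp] [q hq]; exists (p \Po q)%R => n; rewrite horner_comp -hq hp.
Qed.

Lemma leq_nd2 : {homo nd : k l / k <= l}.
Proof. by move=> k l le_kl; rewrite /nd !leq_add // leq_bin2l // leq_mul2l. Qed.

Lemma level_nd k : level (nd k) = k.
Proof.
have lt_nd : nd k < nd k.+1.
  have le2 : 2 * k <= 2 * k.+1 by lia.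
  have := leq_bin2l 2 le2; have := leq_bin2l 3 le2; rewrite /nd !bin1; lia.
have /andP[le_k lt_k] := nd_level (nd k).
apply/eqP; rewrite eqn_leq leqNgt [k <= _]leqNgt; apply/andP; split; apply/negP => /leq_nd2 le_nd.
  by have := leq_trans lt_nd (leq_trans le_nd le_k); rewrite ltnn.
by have := leq_ltn_trans le_nd lt_k; rewrite ltnn.
Qed.

Lemma bin_leq_exp n k : 'C(n, k) <= n ^ k.
Proof.
apply: leq_trans (leq_pmulr _ (fact_gt0 k)) _; rewrite bin_ffact.
elim: k => // k IH; rewrite ffactnSr expnSr leq_mul //; exact: leq_subr.
Qed.

Lemma nd_leq_cube k : nd k <= 3 * ((2 * k) * ((2 * k) * (2 * k))).
Proof.
rewrite /nd; move: (2 * k) => x; case: x => // x.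
have le1 : 'C(x.+1, 1) <= x.+1 ^ 3 by rewrite (leq_trans (bin_leq_exp _ _)) ?leq_pexp2l.
have le2 : 'C(x.+1, 2) <= x.+1 ^ 3 by rewrite (leq_trans (bin_leq_exp _ _)) ?leq_pexp2l.
have := bin_leq_exp x.+1 3; rewrite -[x.+1 * (_ * _)]/(x.+1 ^ 3); lia.
Qed.

Lemma sat3c_nd alpha k (b : (nd k).-tuple bool) :
  sat3c alpha b = selected_satisfiable alpha b.
Proof.
(* The equation [level (nd k) = k] is only propositional; generalising [level _] lets it be
   substituted in the tuple type. *)
rewrite /sat3c; have := level_nd k; move: (level _) => K eK; subst K.
by congr selected_satisfiable; apply: eq_from_tnth => i; rewrite tnth_mktuple -tnth_nth.
Qed.

(** * Instruction sequences that evaluate conjunctive normal forms *)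

Definition eval_lit (s : nat -> bool) (x : nat * bool) : bool := s x.1 == x.2.

Definition eval_cnf (s : nat -> bool) (cls : seq (seq (nat * bool))) : bool :=
  all (has (eval_lit s)) cls.

(* Each literal that holds jumps to the end of the block; the final
   termination instruction is reached, with [Out] still F, if none holds. *)
Fixpoint clause_prog (ls : seq (nat * bool)) : seq instr :=
  if ls is x :: ls' then
    let rest := clause_prog ls' in
    (if x.2 then PosTest (Basic (In x.1) Get) else NegTest (Basic (In x.1) Get))
      :: Jump (size rest).+1 :: rest
  else [:: Term].

Definition cnf_prog (cls : seq (seq (nat * bool))) : seq instr :=
  flatten (map clause_prog cls) ++ [:: Plain (Basic Out (Set_ true)); Term].

Lemma size_clause_prog ls : size (clause_prog ls) = (size ls).*2.+1.
Proof. by elim: ls => //= x ls ->; rewrite doubleS. Qed.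

Lemma cnf_prog_br cls : IS_br (cnf_prog cls).
Proof.
rewrite /IS_br /cnf_prog size_cat addn2 all_cat andbT /=.
elim: cls => //= ls cls IH; rewrite all_cat IH andbT.
by elim: ls => //= -[i []] ls /= ->.
Qed.

Lemma onth_drop_head (T : Type) (X : seq T) p x Y :
  drop p X = x :: Y -> onth X p = Some x.
Proof. by elim: X p => [|y X IH] [|p] //= => [[->]|/IH]. Qed.

Lemma drop_drop_cat (T : Type) (X : seq T) p A Y :
  drop p X = A ++ Y -> drop (p + size A) X = Y.
Proof. by move=> e; rewrite addnC -drop_drop e drop_size_cat. Qed.

(** The position is arbitrary because a satisfied clause jumps to the next block. Input reads leave
    [s] unchanged, so every block starts from the same contents. *)
Lemma exec_cnf n X p cls s :
  drop p X = cnf_prog cls -> all (all (fun x => x.1 < n)) cls ->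
  s Out = false ->
  exists2 s', exec n X p s s' & s' Out = eval_cnf (fun i => s (In i)) cls.
Proof.
move=> eX rg s0; elim: cls p eX rg => [|ls cls IH] p eX rg.
  exists (effect s (Basic Out (Set_ true))) => //.
  apply: exec_plain; [exact: (onth_drop_head eX) | by [] | apply: exec_term].
  apply: (@onth_drop_head _ _ _ _ [::]).
  by rewrite -addn1 (@drop_drop_cat _ _ _ [:: _] _ eX).
have {}eX : drop p X = clause_prog ls ++ cnf_prog cls by rewrite eX /cnf_prog /= catA.
case/andP: rg => rl /[dup] rg {}/IH IH.
rewrite /eval_cnf /=.
elim: ls p eX rl => [|[i b] ls IHl] p eX /=.
  by move=> _; exists s => //; apply: exec_term; apply: (onth_drop_head eX).
case/andP=> lt_i rl.
have eJ : drop p.+1 X = Jump (size (clause_prog ls)).+1 :: (clause_prog ls ++ cnf_prog cls).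
  by rewrite -addn1 (@drop_drop_cat _ _ _ [:: _] _ eX).
have eR : drop p.+2 X = clause_prog ls ++ cnf_prog cls.
  by rewrite -addn1 (@drop_drop_cat _ _ _ [:: _] _ eJ).
have [t et st] : exists2 s', exec n X (if s (In i) == b then p.+1 else p.+2) s s' &
   s' Out = ((s (In i) == b) || has (eval_lit (fun i => s (In i))) ls)
       && eval_cnf (fun i => s (In i)) cls.
  case: eqP => _; last exact: IHl.
  have [|t et st] := IH (p.+2 + size (clause_prog ls)); first exact: drop_drop_cat eR.
  exists t => //; apply: exec_jump; [exact: (onth_drop_head eJ) | by [] |].
  by rewrite addnS -addSn.
exists t => //.
move: eX et; case: b {st} => eX et.
  apply: exec_pos; [exact: (onth_drop_head eX) | by [] |].
  by move: et; rewrite /reply /= eqb_id.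
apply: exec_neg; [exact: (onth_drop_head eX) | by [] |].
by move: et; rewrite /reply /= eqbF_neg; case: (s _).
Qed.

Lemma cnf_computes n cls :
  all (all (fun x => x.1 < n)) cls ->
  computes (cnf_prog cls) (fun b : n.-tuple bool => eval_cnf (nth false b) cls).
Proof. by move=> rg b; apply: exec_cnf; rewrite ?drop0. Qed.

(** * Membership: checking a truth assignment *)

Section Membership.

Variable alpha : clause_numbering.

(** The first literal makes the clause vacuous when bit [j] is F; the others read the truth
    assignment, stored after the [N] input bits. *)
Definition clause_lits (N k : nat) (j : 'I_(nd k)) : seq (nat * bool) :=
  (j : nat, false) ::
    [seq (N + x.1, x.2) | x : literal k <- enum (val (alpha j))].

Definition witness_cnf (N : nat) : seq (seq (nat * bool)) :=
  [seq clause_lits N j | j <- enum 'I_(nd (level N))].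

Lemma witness_cnfP N (s : nat -> bool) :
  reflect (forall j : 'I_(nd (level N)), s j ->
             [exists x in val (alpha j), s (N + x.1) == x.2])
          (eval_cnf s (witness_cnf N)).
Proof.
rewrite /eval_cnf all_map; apply: (iffP allP) => H j.
  move=> sj; have := H j (mem_enum _ _); rewrite /= /eval_lit /= sj /=.
  by rewrite has_map => /hasP[x]; rewrite mem_enum => xA e; apply/exists_inP; exists x.
move=> _; rewrite /= /eval_lit /=; case sj: (s j) => //=.
have /exists_inP[x xA e] := H j sj.
by rewrite has_map; apply/hasP; exists x; rewrite ?mem_enum.
Qed.

Lemma witness_cnf_range N : all (all (fun x => x.1 < N + N)) (witness_cnf N).
Proof.
have /andP[le_N _] := nd_level N.
apply/allP => ls /mapP[j _ ->]; rewrite /= ltn_addr ?(leq_trans (ltn_ord j)) //=.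
rewrite all_map; apply/allP => x _ /=; rewrite ltn_add2l.
exact: leq_trans (ltn_ord _) (leq_trans (leq_nd _) le_N).
Qed.

(** At most 4 literals per clause give at most [2 * 4 + 1 = 9] instructions, for [nd (level N) <= N]
    clauses; 2 more close the program. *)
Lemma size_witness_prog N : size (cnf_prog (witness_cnf N)) <= 9 * N + 2.
Proof.
have /andP[le_N _] := nd_level N.
rewrite size_cat leq_add2r (leq_trans _ (leq_mul (leqnn 9) le_N)) //.
rewrite /witness_cnf -[X in _ <= 9 * X](size_enum_ord).
elim: (enum _) => //= j js IH; rewrite size_cat size_clause_prog size_map -cardE.
have /andP[_ card_j] := valP (alpha j).
by rewrite mulnS -!addSn leq_add // !ltnS (leq_double _ 3).
Qed.

Lemma sat3c_NP : NP_IS (sat3c alpha).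
Proof.
(* Witnesses of [n] bits suffice since [level n <= nd (level n) <= n]; at length [n + n] the
   verifier recovers [n] by halving. *)
exists id, (fun m b => eval_cnf (nth false b) (witness_cnf m./2)); split.
- exact: polynomial_fun_id.
- by [].
- exists (fun m => 9 * m + 2).
    apply: polynomial_fun_add (polynomial_fun_const _).
    exact: polynomial_fun_mul (polynomial_fun_const _) polynomial_fun_id.
  move=> m; exists (cnf_prog (witness_cnf m./2)); split.
  + exact: cnf_prog_br.
  + apply: cnf_computes; apply: sub_all (witness_cnf_range _) => ls.
    by apply: sub_all => x /leq_trans; apply; lia.
  + by apply: leq_trans (size_witness_prog _) _; lia.
move=> n w; have half_n : (n + n)./2 = n by lia.
rewrite half_n /sat3c /selected_satisfiable.
have /andP[le_n _] := nd_level n.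
split=> [/existsP[v /forallP H]|[c /witness_cnfP H]].
  exists [tuple if insub (i : nat) is Some i' then v i' else false | i < n].
  apply/witness_cnfP => j; have lt_j := leq_trans (ltn_ord j) le_n.
  rewrite nth_cat size_tuple lt_j => wj.
  have := H j; rewrite tnth_mktuple wj => /exists_inP[x xA e].
  apply/exists_inP; exists x => //; rewrite nth_cat size_tuple ltnNge leq_addr /= addKn.
  have lt_x : x.1 < n by exact: leq_trans (ltn_ord _) (leq_trans (leq_nd _) le_n).
  by rewrite -[nat_of_ord x.1]/(nat_of_ord (Ordinal lt_x)) nth_mktuple /= valK.
apply/existsP; exists [ffun i : 'I__ => nth false c i]; apply/forallP => j.
rewrite tnth_mktuple; apply/implyP => wj.
have := H j; rewrite nth_cat size_tuple (leq_trans (ltn_ord j) le_n) => /(_ wj).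
case/exists_inP=> x xA; rewrite nth_cat size_tuple ltnNge leq_addr /= addKn => e.
by apply/exists_inP; exists x => //; rewrite ffunE.
Qed.

End Membership.

(** * Execution as an iterated step function, and its locality *)

Definition step (X : seq instr) (q : nat * regs) : nat * regs :=
  let: (p, s) := q in
  match onth X p with
  | Some (Plain a) => (p.+1, effect s a)
  | Some (PosTest a) => (if reply s a then p.+1 else p.+2, effect s a)
  | Some (NegTest a) => (if reply s a then p.+2 else p.+1, effect s a)
  | Some (Jump l) => (p + l, s)
  | _ => (p, s)
  end.

Definition reg_at (X : seq instr) (i : nat) : reg :=
  match onth X i with
  | Some (Plain a) | Some (PosTest a) | Some (NegTest a) => focus a
  | _ => Out
  end.

(** As [step] is the identity at [Term], a halted run keeps its final configuration at all later
    times. *)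
Definition run (X : seq instr) (n : nat) (b : n.-tuple bool) (t : nat) :
    nat * regs :=
  iter t (step X) (0, init b).

(** Jumps only go forward, and those of length 0 have no derivation. So a terminating execution
    takes fewer than [size X] steps. *)
Lemma exec_cases n X p s s' : exec n X p s s' ->
  (onth X p = Some Term /\ s = s') \/
  (p < (step X (p, s)).1 /\ exec n X (step X (p, s)).1 (step X (p, s)).2 s').
Proof.
case=> {}p; [move=> a|move=> a|move=> a|move=> l|] => {}s => [{}s'|{}s'|{}s'|{}s'|] eX;
  last by left.
all: move=> H E; right; rewrite /= eX /=; split=> //; try (by case: ifP); lia.
Qed.

Lemma exec_size n X p s s' : exec n X p s s' -> p < size X.
Proof.
have onth_lt r (u : instr) : onth X r = Some u -> r < size X.
  by rewrite -onthTE => ->.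
by case=> *; apply: onth_lt; eassumption.
Qed.

Lemma exec_run n X (b : n.-tuple bool) t s' :
  exec n X 0 (init b) s' -> exec n X (run X b t).1 (run X b t).2 s'.
Proof.
move=> E; elim: t => //= t; rewrite -/(run X b t); case: (run X b t) => p s /= IH.
case: (exec_cases IH) => [[eX es]|[]//]; by rewrite /= eX.
Qed.

(** With the next lemma: the new position, or one register's new content, depends only on the old
    position and one old register content. Hence triples of trace variables suffice. *)
Lemma step_fst_local X p s s0 :
  s (reg_at X p) = s0 (reg_at X p) -> (step X (p, s)).1 = (step X (p, s0)).1.
Proof.
by rewrite /step /reg_at /reply; case: (onth X p) => [[a|a|a|l|]|] //=; case: (meth a) => // ->.
Qed.

Lemma step_snd_local X p s s0 r :
  s r = s0 r -> (step X (p, s)).2 r = (step X (p, s0)).2 r.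
Proof.
by rewrite /step /effect; case: (onth X p) => [[a|a|a|l|]|] //=; case: (meth a) => //= c ->.
Qed.

(** * Trace variables and the replay of locally accepting assignments *)

Section Trace.

Variables (n : nat) (X : seq instr) (g : n.-tuple bool -> bool).
Hypothesis computes_g : computes X g.
Let L := size X.

(* Trace variables: input bits, "at time t control is at position p", and
   "at time t the register used at position i contains T"; as [reg_at X L] is
   [Out], position L stands for the output register. *)
Definition trace_var : finType := ('I_n + ('I_L.+1 * 'I_L.+1 + 'I_L.+1 * 'I_L.+1))%type.

Definition input_var (i : 'I_n) : trace_var := inl i.
Definition pos_var (t p : nat) : trace_var := inr (inl (inord t, inord p)).
Definition reg_var (t i : nat) : trace_var := inr (inr (inord t, inord i)).

Definition trace (b : n.-tuple bool) (x : trace_var) : bool :=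
  match x with
  | inl i => tnth b i
  | inr (inl (t, p)) => (run X b t).1 == p
  | inr (inr (t, i)) => (run X b t).2 (reg_at X i)
  end.

Lemma trace_pos b t p : t <= L -> p <= L ->
  trace b (pos_var t p) = ((run X b t).1 == p).
Proof. by move=> lt lp; rewrite /= !inordK. Qed.

Lemma trace_reg b t i : t <= L -> i <= L ->
  trace b (reg_var t i) = (run X b t).2 (reg_at X i).
Proof. by move=> lt li; rewrite /= !inordK. Qed.

(** The input [b] may vary with the triple, so [nu] itself need not be a trace. *)
Definition locally_accepting (nu : trace_var -> bool) : Prop :=
  forall x y z : trace_var, exists2 b : n.-tuple bool, g b &
    [/\ nu x = trace b x, nu y = trace b y & nu z = trace b z].

(** Induction on [L - p], with [nu] describing the real configuration at time [t]. The invariant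
    [t <= p] keeps times within [L], where [inord] is faithful. *)
Lemma locally_accepting_exec nu p t s s' :
  locally_accepting nu -> exec n X p s s' -> t <= p -> nu (pos_var t p) ->
  (forall i, i <= L -> nu (reg_var t i) = s (reg_at X i)) -> s' Out.
Proof.
move=> loc; have [d] := ubnP (L - p).
elim: d => // d IH in p t s * => lt_d E le_tp pos_p regs_s.
have lt_p := exec_size E; have le_t : t <= L by lia.
have [[eX <-]|[lt_q E']] := exec_cases E.
  (* An accepting trace agreeing with [nu] on position and output has halted at this same [Term], so
     the common output is T. *)
  have [b gb [epos ereg _]] := loc (pos_var t p) (reg_var t L) (reg_var t L).
  move: epos; rewrite pos_p trace_pos ?(ltnW lt_p) // => /esym/eqP run_p.
  have [sb Eb out_b] := computes_g b; have := exec_run t Eb.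
  have reg_L : reg_at X L = Out by rewrite /reg_at onth_default.
  have := regs_s L (leqnn L); rewrite reg_L => <-.
  rewrite ereg trace_reg // run_p reg_L.
  by case/exec_cases => [[_ ->]|[]]; rewrite ?out_b //= eX ltnn.
have lt_q' := exec_size E'.
apply: (IH (step X (p, s)).1 t.+1 (step X (p, s)).2) => //; try lia.
  set q := (step X (p, s)).1 in lt_q lt_q' *.
  have [b _ [epos ereg ->]] := loc (pos_var t p) (reg_var t p) (pos_var t.+1 q).
  move: epos ereg; rewrite pos_p regs_s ?trace_pos ?trace_pos ?trace_reg ?trace_reg; try lia.
  move/esym/eqP; case E0: (run X b t) => [p0 s0] /= e; subst p0 => ereg.
  by rewrite /= E0 (@step_fst_local _ _ _ s).
move=> i le_i.
have [b _ [epos ereg ->]] := loc (pos_var t p) (reg_var t i) (reg_var t.+1 i).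
move: epos ereg; rewrite pos_p regs_s ?trace_pos ?trace_pos ?trace_reg ?trace_reg; try lia.
move/esym/eqP; case E0: (run X b t) => [p0 s0] /= e; subst p0 => ereg.
by rewrite /= E0; apply: step_snd_local.
Qed.

(** Every trace starts at position 0 with registers determined by its input, so [nu] is correct at
    time 0 for the input read off from it, and the replay applies. *)
Lemma locally_accepting_input nu :
  locally_accepting nu -> g [tuple nu (input_var i) | i < n].
Proof.
move=> loc; set b := [tuple _ | _ < _].
have [s' E <-] := computes_g b; have lt0 := exec_size E.
apply: (locally_accepting_exec (t := 0) loc E) => //.
  have [b' _ [-> _ _]] := loc (pos_var 0 0) (pos_var 0 0) (pos_var 0 0).
  by rewrite trace_pos.
move=> i le_i; rewrite /init.
case er: (reg_at X i) => [j|j|].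
(* Beyond the inputs, [nth] defaults to F on both sides. *)
- have [lt_j|le_j] := ltnP j n; last first.
    have [b' _ [-> _ _]] := loc (reg_var 0 i) (reg_var 0 i) (reg_var 0 i).
    by rewrite trace_reg // er -[LHS]/(nth false b' j) !nth_default ?size_tuple.
  pose j' := Ordinal lt_j.
  have [b' _ [-> ej _]] := loc (reg_var 0 i) (input_var j') (reg_var 0 i).
  rewrite trace_reg // er -[LHS]/(nth false b' (val j')) -[j]/(val j').
  by rewrite -!tnth_nth tnth_mktuple.
- have [b' _ [-> _ _]] := loc (reg_var 0 i) (reg_var 0 i) (reg_var 0 i).
  by rewrite trace_reg //= er.
- have [b' _ [-> _ _]] := loc (reg_var 0 i) (reg_var 0 i) (reg_var 0 i).
  by rewrite trace_reg //= er.
Qed.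

Lemma card_trace_var : #|trace_var| = n + (L.+1 * L.+1 + L.+1 * L.+1).
Proof. by rewrite !card_sum !card_prod !card_ord. Qed.

End Trace.

(** * The reduction: clauses over trace variables *)

Section Reduction.

Variables (alpha : clause_numbering) (n m : nat) (X : seq instr).
Variable g : (n + m).-tuple bool -> bool.
Hypothesis alpha_bijective : forall k : nat, bijective (@alpha k).
Hypothesis computes_g : computes X g.

Let V : finType := trace_var (n + m) X.
Let k := #|V|.

Definition valid_clause (L : {set literal k}) : bool :=
  [forall b : (n + m).-tuple bool, g b ==>
     [exists x in L, trace b (enum_val x.1 : V) == x.2]].

Definition input_clause (w : n.-tuple bool) (i : 'I_n) : {set literal k} :=
  [set (enum_rank (input_var X (lshift m i) : V), tnth w i)].

Definition reduction (j : 'I_(nd k)) (w : n.-tuple bool) : bool :=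
  valid_clause (val (alpha j)) ||
  [exists i : 'I_n, val (alpha j) == input_clause w i].

Lemma clause_number (L : {set literal k}) :
  0 < #|L| <= 3 -> exists j : 'I_(nd k), val (alpha j) = L.
Proof.
move=> cL; have [inv _ invK] := alpha_bijective k.
by exists (inv (exist _ L cL)); rewrite invK.
Qed.

(* If no accepting trace agreed with [nu] at x, y, z, then the clause denying
   the values of [nu] there would be valid, hence satisfied by [nu]. *)
Lemma valid_clauses_locally_accepting (nu : V -> bool) :
  (forall L : {set literal k}, 0 < #|L| <= 3 -> valid_clause L ->
     [exists x in L, nu (enum_val x.1) == x.2]) ->
  locally_accepting g nu.
Proof.
move=> sat x y z.
pose d (u : V) : literal k := (enum_rank u, ~~ nu u).
have [/existsP[b /and4P[gb /eqP ex /eqP ey /eqP ez]]|no] :=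
  boolP [exists b, [&& g b, nu x == trace b x, nu y == trace b y & nu z == trace b z]].
  by exists b.
have cL : 0 < #|[set d x; d y; d z]| <= 3.
  rewrite card_gt0; apply/andP; split; first by apply/set0Pn; exists (d x); rewrite !inE eqxx.
  apply: leq_trans (leq_card_setU _ _) _; rewrite cards1 addn1 ltnS cards2.
  by case: (_ != _).
have /exists_inP[u] : [exists u in [set d x; d y; d z], nu (enum_val u.1) == u.2].
  apply: sat => //; apply/forallP => b; apply/implyP => gb.
  move: no; rewrite negb_exists => /forallP/(_ b); rewrite gb /=.
  rewrite !negb_and => /or3P[] ne; apply/exists_inP.
  - exists (d x); rewrite ?inE ?eqxx //= enum_rankK.
    by move: ne; case: (nu x); case: (trace b x).
  - exists (d y); rewrite ?inE ?eqxx ?orbT //= enum_rankK.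
    by move: ne; case: (nu y); case: (trace b y).
  - exists (d z); rewrite ?inE ?eqxx ?orbT //= enum_rankK.
    by move: ne; case: (nu z); case: (trace b z).
by rewrite !inE => /orP[/orP[]|] /eqP ->; rewrite /= enum_rankK; case: (nu _).
Qed.

Lemma reduction_correct (w : n.-tuple bool) :
  (exists c : m.-tuple bool, g [tuple of w ++ c]) <->
  sat3c alpha [tuple reduction j w | j < nd k].
Proof.
rewrite sat3c_nd; split=> [[c gc]|/existsP[v /forallP sat]].
  apply/existsP; exists [ffun x => trace [tuple of w ++ c] (enum_val x : V)].
  apply/forallP => j; rewrite tnth_mktuple; apply/implyP => /orP[].
    move/forallP/(_ [tuple of w ++ c]); rewrite gc => /exists_inP[x xA e].
    by apply/exists_inP; exists x => //; rewrite ffunE.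
  case/existsP=> i /eqP ->; apply/exists_inP.
  exists (enum_rank (input_var X (lshift m i) : V), tnth w i); first by rewrite inE.
  by rewrite ffunE /= enum_rankK /= tnth_lshift.
pose nu (x : V) := v (enum_rank x).
have loc : locally_accepting g nu.
  apply: valid_clauses_locally_accepting => L cL vL.
  have [j ej] := clause_number cL; have := sat j.
  rewrite tnth_mktuple /reduction ej vL => /exists_inP[x xL e].
  by apply/exists_inP; exists x; rewrite /nu ?enum_valK.
(* The certificate is read off the last [m] input variables; the unit clauses force the first [n] to
   be [w]. *)
exists [tuple nu (input_var X (rshift n i)) | i < m].
have := locally_accepting_input computes_g loc; congr (is_true (g _)).
apply: eq_from_tnth => i; rewrite tnth_mktuple.
case: (split_ordP i) => i' ->; last by rewrite tnth_rshift tnth_mktuple.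
rewrite tnth_lshift.
have [|j ej] := @clause_number (input_clause w i'); first by rewrite cards1.
have := sat j; rewrite tnth_mktuple /reduction ej.
have -> : [exists i0, input_clause w i' == input_clause w i0] by apply/existsP; exists i'.
by rewrite orbT => /exists_inP[x]; rewrite inE => /eqP -> /eqP.
Qed.

Lemma reduction_computable (j : 'I_(nd k)) :
  exists Y : seq instr,
    [/\ IS_br Y, computes Y (reduction j) & size Y <= 5].
Proof.
have prog cls : all (all (fun x => x.1 < n)) cls -> size (cnf_prog cls) <= 5 ->
    (forall w : n.-tuple bool, eval_cnf (nth false w) cls = reduction j w) ->
    exists Y : seq instr,
      [/\ IS_br Y, computes Y (reduction j) & size Y <= 5].
  move=> rg sz eq_red; exists (cnf_prog cls); split=> //; first exact: cnf_prog_br.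
  by move=> b; have [s E out_s] := cnf_computes rg b; exists s; rewrite // -eq_red.
have [valid|invalid] := boolP (valid_clause (val (alpha j))).
  by apply: (prog [::]) => // w; rewrite /reduction valid.
pose unit_at (i : 'I_n) (c : bool) : {set literal k} :=
  [set (enum_rank (input_var X (lshift m i) : V), c)].
have unit_inj i c i' c' : unit_at i c = unit_at i' c' -> i = i' /\ c = c'.
  by move/set1_inj => [/enum_rank_inj[] /val_inj -> ->].
have [/existsP[i /existsP[c /eqP e]]|no] :=
  boolP [exists i, [exists c, val (alpha j) == unit_at i c]].
  (* This clause is selected exactly when bit [i] of [w] is [c]; its program attains the bound, with
     3 + 2 instructions. *)
  apply: (prog [:: [:: (i : nat, c)]]) => [|//|w]; first by rewrite /= ltn_ord.
  rewrite /reduction (negPf invalid) /= orbF andbT /eval_lit /= -tnth_nth.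
  apply/eqP/existsP=> [ew|[i' /eqP]].
    by exists i; rewrite e /input_clause ew.
  by rewrite e => /unit_inj[-> ->].
apply: (prog [:: [::]]) => // w; rewrite /reduction (negPf invalid) /=.
apply/esym/negbTE; apply: contra no => /existsP[i e].
by apply/existsP; exists i; apply/existsP; exists (tnth w i).
Qed.

End Reduction.

(** * Hardness with its polynomial bound, and completeness *)

Lemma sat3c_hard (alpha : clause_numbering) (f : Defs.family) :
  (forall k : nat, bijective (alpha k)) -> NP_IS f ->
  poly_length_reducible f (sat3c alpha).
Proof.
move=> alpha_bij [h [g [poly_h _ [q poly_q prog_g] f_g]]].
(* Bounds the number of trace variables when [size X <= q (n + h n)]. *)
pose N n := (n + h n) + ((q (n + h n) + 1) * (q (n + h n) + 1)
                         + (q (n + h n) + 1) * (q (n + h n) + 1)).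
(* The 5 bounds the program lengths, the cubic term the number of clauses by [nd_leq_cube]. *)
exists (fun n => 5 + 3 * ((2 * N n) * ((2 * N n) * (2 * N n)))).
  have poly_nh := polynomial_fun_add polynomial_fun_id poly_h.
  have poly_L := polynomial_fun_add (polynomial_fun_comp poly_q poly_nh)
                   (polynomial_fun_const 1).
  have poly_LL := polynomial_fun_mul poly_L poly_L.
  have poly_N := polynomial_fun_add poly_nh (polynomial_fun_add poly_LL poly_LL).
  have poly_2N := polynomial_fun_mul (polynomial_fun_const 2) poly_N.
  have poly_8N := polynomial_fun_mul poly_2N (polynomial_fun_mul poly_2N poly_2N).
  exact: polynomial_fun_add (polynomial_fun_const 5)
           (polynomial_fun_mul (polynomial_fun_const 3) poly_8N).
move=> n; have [X [_ comp_X size_X]] := prog_g (n + h n).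
exists 5, (nd #|trace_var (n + h n) X|); split; first exact: leq_addr.
  rewrite (leq_trans _ (leq_addl _ _)) // (leq_trans (nd_leq_cube _)) //.
  have le_N : 2 * #|trace_var (n + h n) X| <= 2 * N n.
    rewrite leq_mul2l /= card_trace_var /N addn1 leq_add2l.
    by rewrite leq_add ?leq_mul.
  exact: leq_mul (leqnn 3) (leq_mul le_N (leq_mul le_N le_N)).
exists (reduction (n := n) (X := X) alpha (@g _)); split.
  exact: reduction_computable.
move=> w; have [to_c of_c] := reduction_correct alpha_bij comp_X w.
have [f_c c_f] := f_g n w.
by apply/idP/idP => [/f_c/to_c|/of_c/c_f].
Qed.

Theorem theorem14 (alpha : clause_numbering)
  (alpha_bijective : forall k : nat, bijective (alpha k))
  (alpha_coherent : coherent alpha)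
  (alpha_polytime : polytime_numbering alpha) :
  NP_IS_complete (sat3c alpha).
Proof.
by split=> [|f]; [apply: sat3c_NP | apply: sat3c_hard].
Qed.
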